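(* Let $l\ge2$ be an integer. (i) Let $q_n=1-\frac cn$ with $c>0$, and let $k_n$ be integers with $k_n\sim dn$ as $n\to\infty$, where $d\in(0,1)$. Then, as $n\to\infty$, $$ P_n^{q_n}(A^{(n)}_{l;k_n})\lesssim \frac1{(1-e^{-cd})^l}\left(\int_{e^{-cd}}^1y^{l-1} \exp\!\Big(\big(\log\tfrac{1-e^{-cd}}{1-e^{-c}}\big)\,e^{cd}\,(l-1)\,y\Big)\,dy\right) \frac{c^{\,l-1}\, l!}{n^{l-1}}. $$ (ii) Let $q_n<1$ with $q_n=1-o(\frac1n)$ as $n\to\infty$. Then for any choice of integers $\{k_n\}_{n=1}^\infty$ with $1\le k_n\le n-l+1$, as $n\to\infty$, $$ P_n^{q_n}(A^{(n)}_{l;k_n})\lesssim \frac{l!}{n^{l-1}}. $$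
   Context: $S_n$ is the set of permutations $\sigma=\sigma_1\sigma_2\cdots\sigma_n$ of $[n]=\{1,\dots,n\}$. For $q>0$, the Mallows distribution with parameter $q$ is the probability measure on $S_n$ given by $P_n^q(\sigma)=\frac{q^{\mathrm{inv}(\sigma)}}{Z_n(q)}$, where $\mathrm{inv}(\sigma)$ is the number of inversions of $\sigma$ and $Z_n(q)$ is the normalizing constant, $Z_n(q)=\prod_{k=1}^n\frac{1-q^k}{1-q}$ (for $q\ne1$). Statements about $P_n^{q_n}$ are for $n$ large enough that $q_n>0$. For $l\ge2$ and $1\le k\le n-l+1$, $A^{(n)}_{l;k}\subset S_n$ is the event that the set of $l$ consecutive numbers $\{k,k+1,\dots,k+l-1\}$ appears in a set of $l$ consecutive positions, i.e. there exists $m\in\{1,\dots,n-l+1\}$ with $\{k,k+1,\dots,k+l-1\}=\{\sigma_m,\sigma_{m+1},\dots,\sigma_{m+l-1}\}$. The notation $a_n\lesssim b_n$ as $n\to\infty$ means $\limsup_{n\to\infty}\frac{a_n}{b_n}\le1$, and $a_n\sim b_n$ means $\lim_{n\to\infty}\frac{a_n}{b_n}=1$. *)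

(* Defs.v *)
From mathcomp Require Import all_boot all_order all_algebra all_fingroup.
From mathcomp Require Import all_classical all_reals all_analysis.
Set Implicit Arguments.
Unset Strict Implicit.
Unset Printing Implicit Defensive.
Import Order.TTheory GRing.Theory Num.Theory numFieldNormedType.Exports.
Local Open Scope ring_scope.

(* Positions and values of a permutation are 0-based ordinals: the
   1-based sigma_i, i in {1, ..., n}, is s (i - 1) + 1. *)

Definition inv (n : nat) (s : 'S_n) : nat :=
  #|[set p : 'I_n * 'I_n | (p.1 < p.2)%N && (s p.2 < s p.1)%N]|.

(* The normalizing constant, as the total weight of S_n; for q != 1 it equals
   \prod_(1 <= k < n.+1) ((1 - q ^+ k) / (1 - q)). *)
Definition mallowsZ (R : realType) (n : nat) (q : R) : R :=
  \sum_(s : 'S_n) q ^+ inv s.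

Definition mallows_pmf (R : realType) (n : nat) (q : R) (s : 'S_n) : R :=
  q ^+ inv s / mallowsZ n q.

(* A probability measure for q > 0, the only range in which it is meaningful. *)
Definition mallows (R : realType) (n : nat) (q : R) (A : {set 'S_n}) : R :=
  \sum_(s in A) mallows_pmf q s.

Lemma mallowsZ_gt0 (R : realType) (n : nat) (q : R) :
  0 < q -> 0 < mallowsZ n q.
Proof.
move=> q0; rewrite /mallowsZ (bigD1 1%g) //= ltr_pwDl ?exprn_gt0 //.
by apply: sumr_ge0 => s _; rewrite exprn_ge0 // ltW.
Qed.

Lemma mallows_setT (R : realType) (n : nat) (q : R) :
  0 < q -> mallows q [set: 'S_n] = 1.
Proof.
move=> q0; rewrite /mallows (eq_bigl xpredT) => [|s]; last by rewrite inE.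
by rewrite /mallows_pmf -mulr_suml divff // gt_eqF // mallowsZ_gt0.
Qed.

(* The event that {k, ..., k+l-1} = {sigma_m, ..., sigma_(m+l-1)} for some m in
   {1, ..., n-l+1}; k and m are 1-based, whence the .+1 on the ordinals. The
   bound m : 'I_n.+1 only makes the search finite. Intended for
   1 <= k <= n-l+1. *)
Definition cluster_event (n l k : nat) : {set 'S_n} :=
  [set s : 'S_n | [exists m : 'I_n.+1,
     [&& 1 <= m, m + l <= n.+1 &
       [set j : 'I_n | k <= j.+1 < k + l]
         == [set s i | i : 'I_n & m <= i.+1 < m + l]]]]%N.

Definition asymp_equiv (R : realType) (a b : nat -> R) : Prop :=
  ((a n / b n) @[n --> \oo] --> (1 : R))%classic.

(* The limsup is taken in the extended reals, so no boundedness is presupposed. *)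
Definition asymp_le (R : realType) (a b : nat -> R) : Prop :=
  (limn_esup (fun n => (a n / b n)%:E) <= 1)%E.

(* Main.v *)
Require Import Defs.
From mathcomp Require Import all_boot all_order all_algebra all_fingroup.
From mathcomp Require Import all_classical all_reals all_analysis.
From mathcomp Require Import zify ring lra.

(* Build the permutation by inserting the values 1, 2, ... one at a time; value
   i, placed with j of the smaller values to its right, contributes q^j. Once
   k, ..., k+l-1 form a block with a of the values below k to its right, later
   values must avoid the l-1 gaps of the block. When i is inserted, at most
   a + (i-k-l) values lie to the right of the block, so each forbidden gap has
   weight at least q^(a+i-k). This gives
     P(A) <= l! / prod_(k <= i < k+l) [i] * sum_(a < k)
               q^(la) prod_(k+l <= i <= n) (1 - (l-1) q^(a+i-k) / [i])
   with [i] = 1 + q + ... + q^(i-1). For (i), 1 - x <= exp(-x) and a telescoping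
   logarithm turn the product into exp(-B q^a), and the sum over a is a Riemann
   sum on the geometric grid q^a. For (ii), Bernoulli's inequality compares the
   bound with its value at q = 1, up to q^(-nl) and (1 + l^2 (1-q))^n. *)

Set Implicit Arguments.
Unset Strict Implicit.
Unset Printing Implicit Defensive.
Import Order.TTheory GRing.Theory Num.Theory numFieldNormedType.Exports.
Local Open Scope ring_scope.

(* [inv] alone is the function inverse of mathcomp's [functions]. *)
Local Notation inv := Defs.inv.

(** * Inserting the largest value *)

Lemma inv_sum (n : nat) (s : 'S_n) :
  inv s = (\sum_(x < n) \sum_(y < n) ((x < y) && (s y < s x)))%N.
Proof.
by rewrite /inv -sum1dep_card pair_big big_mkcond.
Qed.

Lemma widen_lift_max (n : nat) (i : 'I_n) :
  widen_ord (leqnSn n) i = lift ord_max i.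
Proof. exact/val_inj/esym/lift_max. Qed.

Lemma ltn_lift (n : nat) (j : 'I_n.+1) (x y : 'I_n) :
  (lift j x < lift j y)%N = (x < y)%N.
Proof. by rewrite /= /bump; do 2!case: leqP => ? /=; lia. Qed.

Lemma lift_lt (n : nat) (j : 'I_n.+1) (x : 'I_n) :
  (lift j x < j)%N = (x < j)%N.
Proof. by rewrite /= /bump; case: leqP => ? /=; lia. Qed.

Lemma lift_gt (n : nat) (j : 'I_n.+1) (x : 'I_n) :
  (j < lift j x)%N = (j <= x)%N.
Proof. by rewrite /= /bump; case: leqP => ? /=; lia. Qed.

Lemma card_leq_perm (n m : nat) (s : 'S_n) : (m <= n)%N ->
  (\sum_(x < n) (m <= s x) = n - m)%N.
Proof.
move=> mn.
rewrite -(reindex_inj (@perm_inj _ s) (P := predT)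
            (F := fun x : 'I_n => (m <= x)%N : nat)).
rewrite -(big_mkord predT (fun x => (m <= x)%N : nat)).
rewrite (big_cat_nat (leq0n m) mn) /=.
rewrite big_nat big1 => [|x /andP[_ xm]]; last by rewrite leqNgt xm.
rewrite add0n big_nat (eq_bigr (fun=> 1%N)) => [|x /andP[-> _] //].
by rewrite -big_nat sum_nat_const_nat muln1.
Qed.

(** Read [s] as a map from values to positions: [ord_max] is the new largest value, put at position
    [j]. It is inverted with the n - j values to its right, and [lift] keeps the order of the
    others. *)
Lemma inv_lift_perm (n : nat) (j : 'I_n.+1) (s : 'S_n) :
  inv (lift_perm ord_max j s) = (inv s + (n - j))%N.
Proof.
rewrite !inv_sum big_ord_recr /= [X in (_ + X)%N]big1 ?addn0; last first.
  by move=> y _; rewrite ltnNge leq_ord.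
rewrite -(card_leq_perm s (leq_ord j)).
rewrite -big_split; apply: eq_bigr => x _.
rewrite big_ord_recr /=; congr (_ + _)%N; last first.
  rewrite widen_lift_max lift_perm_id lift_perm_lift ltn_ord /= /bump.
  by congr nat_of_bool; case: leqP => ? /=; lia.
by apply: eq_bigr => y _; rewrite !widen_lift_max !lift_perm_lift !ltn_lift.
Qed.

Lemma lift_perm_bij (n : nat) :
  bijective (fun p : 'I_n.+1 * 'S_n => lift_perm ord_max p.1 p.2).
Proof.
apply: inj_card_bij => [[j s] [j' s'] /= e|]; last first.
  by rewrite card_prod card_ord !card_Sn factS.
have ej : j = j' by move/permP/(_ ord_max): e; rewrite !lift_perm_id.
congr pair => //; apply/permP => x.
by move/permP/(_ (lift ord_max x)): e; rewrite !lift_perm_lift -ej => /lift_inj.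
Qed.

Lemma sum_lift_perm (R : realType) (n : nat) (F : 'S_n.+1 -> R) :
  \sum_(t : 'S_n.+1) F t =
  \sum_(s : 'S_n) \sum_(j < n.+1) F (lift_perm ord_max j s).
Proof.
rewrite exchange_big pair_big (reindex _ (onW_bij _ (lift_perm_bij n))).
by apply: eq_bigr => -[].
Qed.

(** The map sending [(x, y)] to [(s y, s x)] matches the inversions of [s] with those of its
    inverse. Weights computed on inverses thus carry back to the permutation. *)
Lemma inv_permV (n : nat) (s : 'S_n) : inv (s^-1)%g = inv s.
Proof.
have swapI : injective (fun p : 'I_n * 'I_n => (s p.2, s p.1)).
  by move=> [a b] [c d] [] /perm_inj -> /perm_inj ->.
rewrite /inv -[RHS](card_imset _ swapI).
apply: eq_card => -[x y]; rewrite inE /=.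
apply/idP/imsetP => [h|[[a b]]].
  exists ((s^-1)%g y, (s^-1)%g x); rewrite ?inE /= ?permKV //.
  by rewrite andbC.
by rewrite inE /= => /andP[h1 h2] [-> ->]; rewrite !permK h1 h2.
Qed.

(** The q-integer [n]: the total weight of the n positions open to the n-th inserted value. *)
Definition qint (R : realType) (q : R) (n : nat) : R := \sum_(j < n) q ^+ j.

Lemma qint_rev (R : realType) (q : R) (n : nat) :
  \sum_(j < n.+1) q ^+ (n - j) = qint q n.+1.
Proof.
rewrite /qint (reindex_inj rev_ord_inj) /=; apply: eq_bigr => j _.
by congr (_ ^+ _); have := ltn_ord j; lia.
Qed.

Lemma mallowsZS (R : realType) (q : R) (n : nat) :
  mallowsZ n.+1 q = mallowsZ n q * qint q n.+1.
Proof.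
rewrite /mallowsZ sum_lift_perm mulr_suml; apply: eq_bigr => s _.
rewrite -qint_rev mulr_sumr; apply: eq_bigr => j _.
by rewrite inv_lift_perm exprD.
Qed.

(** * Weight of the permutations with a block *)

(* [t] is the inverse of the permutation of interest: it maps a value to its
   position, both 0-based. The block is the set of values [K, K + l), cut at [n]
   while it is still being inserted. *)
Definition block_convex (K l n : nat) (t : 'S_n) : bool :=
  [forall u : 'I_n, forall v : 'I_n, forall w : 'I_n,
     [&& K <= u < K + l, K <= v < K + l, t u < t w & t w < t v] ==>
     (K <= w < K + l)]%N.

(** The first block value K stands for the whole block, since in a convex block no smaller value
    separates its elements. Quantifying over [u] keeps a proof of K < n out of the definition. *)
Definition right_of (K n : nat) (t : 'S_n) : {set 'I_n} :=
  [set w : 'I_n | (w < K)%N &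
     [forall u : 'I_n, (u == K :> nat) ==> (t u < t w)%N]].

(** The weight is split by [a] because this number is fixed once K is inserted and controls the cost
    of every later insertion. *)
Definition block_weight (R : realType) (q : R) (K l a n : nat) : R :=
  \sum_(t : 'S_n | block_convex K l t && (#|right_of K t| == a)) q ^+ inv t.

Lemma block_convexP (K l n : nat) (t : 'S_n) :
  reflect (forall u v w : 'I_n, K <= u < K + l -> K <= v < K + l ->
             t u < t w -> t w < t v -> K <= w < K + l)%N
          (block_convex K l t).
Proof.
apply: (iffP forallP) => [h u v w hu hv h1 h2|h u].
  by have /forallP/(_ v)/forallP/(_ w) := h u; rewrite hu hv h1 h2.
apply/forallP => v; apply/forallP => w; apply/implyP => /and4P[].
exact: h.
Qed.

(** A block once broken is never repaired by a later insertion, so only convex [t] need to be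
    extended. *)
Lemma block_convex_lift (K l n : nat) (j : 'I_n.+1) (t : 'S_n) :
  block_convex K l (lift_perm ord_max j t) -> block_convex K l t.
Proof.
move=> /block_convexP h; apply/block_convexP => u v w hu hv h1 h2.
have := h (lift ord_max u) (lift ord_max v) (lift ord_max w).
by rewrite !lift_perm_lift !ltn_lift !lift_max; apply.
Qed.

Lemma right_of_ltP (K n : nat) (Kn : (K < n)%N) (t : 'S_n) (w : 'I_n) :
  (w \in right_of K t) = ((w < K) && (t (Ordinal Kn) < t w))%N.
Proof.
rewrite inE; congr andb; apply/forallP/idP => [/(_ (Ordinal Kn))/implyP|h u].
  exact.
by apply/implyP => /eqP e; rewrite (_ : u = Ordinal Kn) //; apply: val_inj.
Qed.

Lemma card_right_of_lift (K n : nat) (j : 'I_n.+1) (t : 'S_n) : (K < n)%N ->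
  #|right_of K (lift_perm ord_max j t)| = #|right_of K t|.
Proof.
move=> Kn; have Kn1 : (K < n.+1)%N by rewrite ltnW.
rewrite -(card_imset _ (@lift_inj _ (ord_max : 'I_n.+1))); apply: eq_card => w.
have eK : Ordinal Kn1 = lift ord_max (Ordinal Kn).
  exact/val_inj/esym/lift_max.
apply/idP/imsetP => [|[w' hw ->]].
  case: (unliftP ord_max w) => [w' ->|->].
    rewrite (right_of_ltP Kn1) eK !lift_perm_lift ltn_lift lift_max => h.
    by exists w' => //; rewrite (right_of_ltP Kn).
  by rewrite inE /= ltnNge (ltnW Kn).
rewrite (right_of_ltP Kn1) eK !lift_perm_lift ltn_lift lift_max.
by rewrite -right_of_ltP.
Qed.

Lemma card_gt_perm (n : nat) (t : 'S_n.+1) (j : 'I_n.+1) :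
  #|[set w | (j < t w)%N]| = (n - j)%N.
Proof.
rewrite -sum1dep_card big_mkcond -[RHS](@card_leq_perm n.+1 j.+1 t) //.
Qed.

Lemma block_weight_step (R : realType) (q C : R) (K l a n : nat) :
  0 <= q -> (K < n)%N ->
  (forall t : 'S_n, block_convex K l t -> #|right_of K t| = a ->
     \sum_(j < n.+1 | block_convex K l (lift_perm ord_max j t)) q ^+ (n - j)
       <= C) ->
  block_weight q K l a n.+1 <= block_weight q K l a n * C.
Proof.
move=> q0 Kn hC; rewrite /block_weight big_mkcond sum_lift_perm mulr_suml.
rewrite [leRHS]big_mkcond /=; apply: ler_sum => t _.
under eq_bigr do rewrite card_right_of_lift //.
case: eqP => [ha|_]; last first.
  by rewrite andbF big1 // => j _; rewrite andbF.
under eq_bigr do rewrite andbT.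
rewrite andbT -big_mkcond /=.
have [hb|hb] := boolP (block_convex K l t); last first.
  rewrite big1 // => j /block_convex_lift; by rewrite (negbTE hb).
under eq_bigr do rewrite inv_lift_perm exprD.
by rewrite -mulr_sumr ler_wpM2l ?exprn_ge0 // hC.
Qed.

(** While K is the largest value, everything to its right is smaller, so [a] forces its position j =
    K - a and the extra weight q^a. *)
Lemma block_weight_base (R : realType) (q : R) (K l a : nat) : 0 <= q ->
  block_weight q K l a K.+1 <= mallowsZ K q * q ^+ a.
Proof.
move=> q0; rewrite /block_weight big_mkcond sum_lift_perm mulr_suml.
apply: ler_sum => t _; rewrite -big_mkcond.
apply: (@le_trans _ _ (\sum_(j < K.+1 | (K - j)%N == a) q ^+ (inv t + a))).
  rewrite big_mkcond [leRHS]big_mkcond /=; apply: ler_sum => j _.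
  case: ifP => [/andP[_]|_]; last by case: ifP => // _; rewrite exprn_ge0.
  rewrite (_ : #|_| = (K - j)%N) => [/eqP <-|].
    by rewrite eqxx inv_lift_perm.
  rewrite -[RHS](card_gt_perm (lift_perm ord_max j t)); apply: eq_card => w.
  rewrite (right_of_ltP (ltnSn K)) inE.
  rewrite (_ : Ordinal _ = ord_max); last exact: val_inj.
  rewrite lift_perm_id.
  case: (unliftP ord_max w) => [w' ->|->]; last by rewrite lift_perm_id !ltnn.
  by rewrite lift_max ltn_ord.
rewrite sumr_const exprD -[leRHS]mulr1n ler_wpMn2l ?mulr_ge0 ?exprn_ge0 //.
apply/card_le1_eqP => i j; rewrite !unfold_in => /eqP hi /eqP hj.
apply: val_inj => /=; have := ltn_ord i; have := ltn_ord j.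
by move: hi hj => /=; lia.
Qed.

(** The new value joins the block, so to its right lie the [a] values below K that are right of the
    block and some of the n - K block values present. Hence n - j takes at most n - K + 1 values,
    each at least [a]. *)
Lemma block_insert_inside (R : realType) (q : R) (K l n : nat) (t : 'S_n) :
  0 <= q <= 1 -> (K < n < K + l)%N ->
  \sum_(j < n.+1 | block_convex K l (lift_perm ord_max j t)) q ^+ (n - j)
    <= (n - K).+1%:R * q ^+ #|right_of K t|.
Proof.
move=> /andP[q0 q1] /andP[Kn nKl]; set a := #|_|.
have hj (j : 'I_n.+1) : block_convex K l (lift_perm ord_max j t) ->
    (a <= n - j <= a + (n - K))%N.
  set s := lift_perm _ _ _ => /block_convexP cv.
  have sj : s ord_max = j by rewrite /s lift_perm_id.
  have Kn1 : (K < n.+1)%N by rewrite ltnW.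
  have sne w : w != ord_max -> (s w == j :> nat) = false.
    move=> wm; apply/negbTE; apply: contra wm => /eqP e.
    by apply/eqP/(@perm_inj _ s); rewrite sj; apply: val_inj.
  (* A value below K that is right of only one of K and the new value would lie between them,
     against convexity. *)
  have e : [set w | (j < s w)%N] :&: [set w : 'I_n.+1 | (w < K)%N]
      = right_of K s.
    apply/setP => w; rewrite finset.in_setI (right_of_ltP Kn1) !inE andbC.
    case wK : (w < K)%N => //=.
    have wm : w != ord_max by apply: contraTneq wK => -> /=; lia.
    have wk : (s w == s (Ordinal Kn1) :> nat) = false.
      apply/negbTE; apply: contraTneq wK => /val_inj/perm_inj -> /=; lia.
    have := sne _ wm.
    have := cv (Ordinal Kn1) ord_max w; have := cv ord_max (Ordinal Kn1) w.
    have -> /= : (K <= @ord_max n < K + l)%N by rewrite /= ltnW.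
    have -> : (K <= K < K + l)%N by lia.
    rewrite sj => /(_ isT isT) h1 /(_ isT isT) h2; move: h1 h2 wk wK.
    move: (s w : nat) (s (Ordinal _) : nat) (j : nat) (w : nat) => x y z w0.
    by clear; lia.
  have := card_gt_perm s j.
  rewrite -(cardsID [set w : 'I_n.+1 | (w < K)%N]) e card_right_of_lift //.
  rewrite -/a => <-; rewrite leq_addr leq_add2l /=.
  rewrite -[leqRHS]card_ord.
  have nK0 : (0 < n - K)%N by lia.
  (* The other values right of the new one are block values, so w - K < n - K and the default of
     [insubd] is never reached. *)
  pose f (w : 'I_n.+1) : 'I_(n - K) := insubd (Ordinal nK0) (w - K)%N.
  apply: (@leq_card_in _ _ f) => x y.
  have fE z : z \in [set w | (j < s w)%N] :\: [set w : 'I_n.+1 | (w < K)%N] ->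
     (z >= K)%N /\ f z = (z - K)%N :> nat.
    rewrite !inE -leqNgt => /andP[zK jz]; split => //.
    rewrite /f val_insubd ifT //.
    have : z != ord_max by apply: contraTneq jz => ->; rewrite sj ltnn.
    rewrite -val_eqE /=; have := ltn_ord z; lia.
  move=> /fE[xK xE] /fE[yK yE] fxy; apply: val_inj => /=.
  by move: xE yE; rewrite fxy; lia.
apply: (@le_trans _ _
   (\sum_(j < n.+1 | (a <= n - j <= a + (n - K))%N) q ^+ a)).
  rewrite big_mkcond [leRHS]big_mkcond /=; apply: ler_sum => j _.
  case: ifP => [/hj|_]; last by case: ifP => // _; rewrite exprn_ge0.
  by move=> h; rewrite h; case/andP: h => h _; rewrite ler_wiXn2l.
rewrite sumr_const mulr_natl ler_wpMn2l ?exprn_ge0 //.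
rewrite -[leqRHS]card_ord.
pose f (w : 'I_n.+1) : 'I_(n - K).+1 := inord (n - w - a).
apply: (@leq_card_in _ _ f) => x y; rewrite !unfold_in => hx hy.
move/(congr1 val); rewrite /= !inordK; [|lia|lia] => exy; apply: val_inj => /=.
have := ltn_ord x; have := ltn_ord y; lia.
Qed.

Lemma card_lt_perm (n m : nat) (t : 'S_n) : (m <= n)%N ->
  #|[set w | (t w < m)%N]| = m.
Proof.
move=> mn; have := finset.cardsC [set w | (m <= t w)%N].
rewrite -sum1dep_card big_mkcond card_leq_perm // card_ord.
rewrite (_ : ~: _ = [set w | (t w < m)%N]); first by lia.
by apply/setP => w; rewrite !inE -ltnNge.
Qed.

Lemma card_lt_ord (n m : nat) : (m <= n)%N ->
  #|[set w : 'I_n | (w < m)%N]| = m.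
Proof.
move=> mn; rewrite -[RHS](card_lt_perm 1%g mn).
by apply: eq_card => w; rewrite !inE perm1.
Qed.

(** Placing the new value just left of a block element other than the leftmost breaks the block.
    These are l - 1 forbidden positions, and since K - a smaller values precede the block, each has
    weight at least q^(a + n - K). *)
Lemma block_insert_outside (R : realType) (q : R) (K l n : nat) (t : 'S_n) :
  0 <= q <= 1 -> (0 < l)%N -> (K + l <= n)%N -> block_convex K l t ->
  \sum_(j < n.+1 | block_convex K l (lift_perm ord_max j t)) q ^+ (n - j)
    <= qint q n.+1 - l.-1%:R * q ^+ (#|right_of K t| + (n - K)).
Proof.
move=> /andP[q0 q1] l0 Kln /block_convexP cv; set a := #|_|.
have Kn : (K < n)%N by lia.
pose B := [set v : 'I_n | (K <= v < K + l)%N].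
have KB : Ordinal Kn \in B by rewrite inE /=; lia.
pose u := [arg min_(v < Ordinal Kn in B) t v].
have [uB umin] : u \in B /\ forall v, v \in B -> (t u <= t v)%N.
  by rewrite /u; case: arg_minnP.
(* [lift ord_max (t v)] is the number t v as a position in the longer permutation: the new value
   lands immediately left of [v]. *)
pose F := [set lift ord_max (t v) | v in B :\ u].
pose ok j := block_convex K l (lift_perm ord_max j t).
rewrite -qint_rev [X in _ <= X - _](bigID ok) /=.
rewrite -addrA lerDl subr_ge0.
have bad (v : 'I_n) : v \in B :\ u ->
    ~~ block_convex K l (lift_perm ord_max (lift ord_max (t v)) t).
  move=> vF; move: (vF); rewrite finset.in_setD1 => /andP[vu vB].
  apply/negP => /block_convexP /(_ (lift ord_max u) (lift ord_max v) ord_max).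
  rewrite !lift_perm_lift lift_perm_id lift_lt lift_gt !lift_max.
  have tuv : (t u < t v)%N.
    rewrite ltn_neqAle umin // andbT; apply: contraNneq vu => /val_inj/perm_inj.
    by move->.
  move: uB vB; rewrite !inE => -> -> /(_ isT isT).
  by rewrite tuv leqnn => /(_ isT isT) /=; lia.
(* The K - a values below K that are not right of K all precede [v], or they would split the
   block. *)
have bad_pos (v : 'I_n) : v \in B -> (K - a <= t v)%N.
  rewrite inE => vB.
  rewrite -(card_lt_perm t (ltnW (ltn_ord (t v)))).
  have <- : (#|[set w : 'I_n | (w < K)%N] :\: right_of K t| = K - a)%N.
    rewrite cardsD (finset.setIidPr _) ?card_lt_ord ?(ltnW Kn) //.
    by apply/fintype.subsetP => w; rewrite (right_of_ltP Kn) inE => /andP[].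
  apply/subset_leq_card/fintype.subsetP => w.
  rewrite finset.in_setD (right_of_ltP Kn) !inE => /andP[+ wK].
  rewrite wK /= -leqNgt => h.
  have wk : (t w == t (Ordinal Kn) :> nat) = false.
    apply/negbTE; apply: contraTneq wK => /val_inj/perm_inj -> /=; lia.
  have wv : (t w == t v :> nat) = false.
    apply/negbTE; apply: contraTneq wK => /val_inj/perm_inj -> /=; lia.
  have := cv v (Ordinal Kn) w vB; rewrite /=; lia.
have -> : \sum_(j < n.+1 | ~~ ok j) q ^+ (n - j) =
    \sum_(j < n.+1 | (j \notin F) && ~~ ok j) q ^+ (n - j) +
    \sum_(j in F) q ^+ (n - j).
  rewrite (bigID (mem F)) /= addrC; congr (_ + _).
    by apply: eq_bigl => j; rewrite andbC.
  apply: eq_bigl => j; rewrite andbC; case jF : (j \in F) => //=.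
  by case/imsetP: jF => v /bad h ->.
apply: (@le_trans _ _ (\sum_(j in F) q ^+ (n - j))); last first.
  by rewrite lerDr sumr_ge0 // => j _; rewrite exprn_ge0.
rewrite big_imset /=; last by move=> x y _ _ /lift_inj/perm_inj.
apply: (@le_trans _ _ (\sum_(v in B :\ u) q ^+ (a + (n - K)))).
  rewrite sumr_const mulr_natl ler_wpMn2l ?exprn_ge0 //.
  have := cardsD1 u B; rewrite uB add1n => cB.
  suff -> : l = #|B| by rewrite cB.
  rewrite (_ : B =
    [set v : 'I_n | (v < K + l)%N] :\: [set v : 'I_n | (v < K)%N]).
    rewrite cardsD (finset.setIidPr _) ?card_lt_ord ?(ltnW Kn) ?addKn //.
    by apply/fintype.subsetP => w; rewrite !inE; lia.
  by apply/setP => w; rewrite !inE -leqNgt.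
apply: ler_sum => v; rewrite finset.in_setD1 => /andP[_ /bad_pos hv].
by rewrite ler_wiXn2l // [X in (n - X)%N]lift_max; lia.
Qed.

Lemma qint_ge0 (R : realType) (q : R) (n : nat) : 0 <= q -> 0 <= qint q n.
Proof. by move=> q0; apply: sumr_ge0 => i _; rewrite exprn_ge0. Qed.

Lemma qint_gt0 (R : realType) (q : R) (n : nat) : 0 < q -> 0 < qint q n.+1.
Proof.
move=> q0; rewrite /qint big_ord_recl expr0 ltr_pwDl //.
by apply: sumr_ge0 => i _; rewrite exprn_ge0 // ltW.
Qed.

Lemma qint_lower (R : realType) (q : R) (n m : nat) : 0 <= q <= 1 ->
  (m <= n.+1)%N -> m%:R * q ^+ n <= qint q n.+1.
Proof.
move=> /andP[q0 q1] mn; apply: (@le_trans _ _ (n.+1%:R * q ^+ n)).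
  by rewrite ler_wpM2r ?exprn_ge0 // ler_nat.
rewrite mulr_natl -[X in _ *+ X]card_ord -sumr_const; apply: ler_sum => i _.
by rewrite ler_wiXn2l // -ltnS.
Qed.

Lemma leq_qint (R : realType) (q : R) (n m : nat) : 0 <= q ->
  (m <= n)%N -> qint q m <= qint q n.
Proof.
move=> q0 mn; rewrite -(subnKC mn) /qint big_split_ord /= lerDl.
by apply: sumr_ge0 => i _; rewrite exprn_ge0.
Qed.

Lemma mallowsZ_prod (R : realType) (q : R) (m n : nat) : (m <= n)%N ->
  mallowsZ n q = mallowsZ m q * \prod_(m <= i < n) qint q i.+1.
Proof.
elim: n => [|n IHn] mn; first by rewrite big_geq // mulr1; congr mallowsZ; lia.
move: mn; rewrite leq_eqVlt => /predU1P[->|mn]; first by rewrite big_geq ?mulr1.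
by rewrite mallowsZS IHn // big_nat_recr //= mulrA.
Qed.

(** The successive block values have 1, 2, ..., m + 1 places open to them, whence the factorial, and
    each place has weight at most q^a. *)
Lemma block_weight_build (R : realType) (q : R) (K l a m : nat) : 0 <= q <= 1 ->
  (m < l)%N ->
  block_weight q K l a (K + m.+1) <=
    mallowsZ K q * ((m.+1)`!%:R * q ^+ (a * m.+1)).
Proof.
move=> q01; have /andP[q0 q1] := q01; elim: m => [|m IHm] ml.
  by rewrite addn1 muln1 (_ : 1`! = 1)%N // mul1r block_weight_base.
rewrite addnS.
apply: le_trans (block_weight_step (C := m.+2%:R * q ^+ a) q0 _ _) _.
- by rewrite addnS ltnS leq_addr.
- move=> t _ ht; have := @block_insert_inside _ q K l (K + m.+1) t q01.
  rewrite ht addKn; apply; lia.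
- apply: le_trans (ler_wpM2r _ (IHm (ltnW ml))) _.
    by rewrite mulr_ge0 ?exprn_ge0.
  rewrite [(m.+2)`!]factS natrM [(a * m.+2)%N]mulnS exprD le_eqVlt.
  by apply/orP; left; apply/eqP; ring.
Qed.

(* Bounds the probability that inserting the 0-based value [i] keeps the block
   together. *)
Definition keep_factor (R : realType) (q : R) (K l a i : nat) : R :=
  1 - l.-1%:R * q ^+ (a + (i - K)) / qint q i.+1.

(** [i+1] contains at least l - 1 terms of size at least q^(i-K). Nonnegativity is what allows
    products of these factors to be compared factor by factor. *)
Lemma keep_factor_ge0 (R : realType) (q : R) (K l a i : nat) : 0 < q <= 1 ->
  (0 < l)%N -> (K + l <= i)%N -> 0 <= keep_factor q K l a i.
Proof.
move=> /andP[q0 q1] l0 Ki; rewrite /keep_factor subr_ge0.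
rewrite ler_pdivrMr ?qint_gt0 // mul1r.
apply: le_trans (leq_qint (m := (i - K).+1) (ltW q0) _); last by lia.
apply: le_trans (qint_lower (m := l.-1) _ _); [|by rewrite ltW|by lia].
by rewrite ler_wpM2l // ler_wiXn2l ?(ltW q0) //; lia.
Qed.

(** The block is complete at n = K + l, where [block_weight_build] applies; each later insertion
    multiplies by [n+1] and a [keep_factor]. The q-integers are absorbed in [mallowsZ], ready to
    cancel on normalization. *)
Lemma block_weight_le (R : realType) (q : R) (K l a n : nat) : 0 < q <= 1 ->
  (0 < l)%N -> (K + l <= n)%N ->
  block_weight q K l a n <= mallowsZ n q / (\prod_(K <= i < K + l) qint q i.+1)
    * (l`!%:R * q ^+ (a * l)) * \prod_(K + l <= i < n) keep_factor q K l a i.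
Proof.
move=> q01 l0; have /andP[q0 q1] := q01.
have p0 (x y : nat) : 0 < \prod_(x <= i < y) qint q i.+1.
  by apply: prodr_gt0 => i _; rewrite qint_gt0.
elim: n => [|n IHn] Kn; first by lia.
have [Kn'|Kn'] := leqP (K + l) n; last first.
  have -> : n.+1 = (K + l)%N by lia.
  rewrite [X in _ * X]big_geq // mulr1 (@mallowsZ_prod _ q K) ?leq_addr //.
  rewrite mulfK ?gt_eqF //.
  have := @block_weight_build _ q K l a l.-1; rewrite prednK //; apply.
    by rewrite ltW.
  by lia.
apply: le_trans (block_weight_step
  (C := qint q n.+1 - l.-1%:R * q ^+ (a + (n - K))) (ltW q0) _ _) _.
  by lia.
  by move=> t ht <-; apply: block_insert_outside; rewrite // ltW.
have -> : qint q n.+1 - l.-1%:R * q ^+ (a + (n - K)) =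
    qint q n.+1 * keep_factor q K l a n.
  by rewrite /keep_factor mulrBr mulr1 mulrCA divff ?mulr1 // gt_eqF ?qint_gt0.
apply: le_trans (ler_wpM2r _ (IHn Kn')) _.
  by rewrite mulr_ge0 ?qint_ge0 ?keep_factor_ge0 // ltW.
rewrite big_nat_recr //= mallowsZS le_eqVlt; apply/orP; left; apply/eqP; ring.
Qed.

(** The event puts the block values in an interval of positions, which is convex. [K.+1] and [m.-1]
    translate between the 1-based k, m and 0-based ordinals. *)
Lemma cluster_event_convex (n l K : nat) (s : 'S_n) :
  s \in cluster_event n l K.+1 -> block_convex K l (s^-1)%g.
Proof.
rewrite inE => /existsP[m /and3P[m1 mln /eqP e]].
have mem (x : 'I_n) : (K <= x < K + l)%N = (m.-1 <= (s^-1)%g x < m.-1 + l)%N.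
  move/setP/(_ x): e; rewrite inE ltnS addSn ltnS => ->.
  apply/imsetP/idP => [[i]|h].
    rewrite !inE => hi ->; rewrite permK; lia.
  exists ((s^-1)%g x); rewrite ?permKV // !inE; lia.
by apply/block_convexP => u v w; rewrite !mem; lia.
Qed.

(** The inverse [t] of each permutation in the event is counted by exactly one block weight with a
    <= K, so the event weighs at most their sum. *)
Lemma mallows_cluster_le (R : realType) (q : R) (n l K : nat) : 0 < q <= 1 ->
  (0 < l)%N -> (K + l <= n)%N ->
  mallows q (cluster_event n l K.+1) <=
  l`!%:R / (\prod_(K <= i < K + l) qint q i.+1) *
  \sum_(a < K.+1) (q ^+ (a * l) * \prod_(K + l <= i < n) keep_factor q K l a i).
Proof.
move=> q01 l0 Kn; have /andP[q0 q1] := q01.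
have Z0 : 0 < mallowsZ n q by rewrite mallowsZ_gt0.
rewrite /mallows /mallows_pmf -mulr_suml ler_pdivrMr //.
apply: (@le_trans _ _ (\sum_(a < K.+1) block_weight q K l a n)); last first.
  rewrite mulrC mulr_sumr mulr_sumr; apply: ler_sum => a _.
  apply: le_trans (block_weight_le _ q01 l0 Kn) _.
  by rewrite le_eqVlt; apply/orP; left; apply/eqP; ring.
rewrite /block_weight (exchange_big_dep predT) //= (reindex_inj invg_inj) /=.
rewrite big_mkcond; apply: ler_sum => t _.
case: ifP => [/cluster_event_convex|_]; last first.
  by apply: sumr_ge0 => a _; rewrite exprn_ge0 // ltW.
rewrite invgK => ht; rewrite ht /=.
have hK : (#|right_of K t| < K.+1)%N.
  rewrite ltnS -[leqRHS](@card_lt_ord n); last by lia.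
  by apply/subset_leq_card/fintype.subsetP => w; rewrite !inE => /andP[].
rewrite (big_pred1 (Ordinal hK)) ?inv_permV //.
Qed.

(** * Bounds uniform in the block *)

Lemma prod_succ_fact (m n : nat) : (m <= n)%N ->
  (m`! * \prod_(m <= i < n) i.+1 = n`!)%N.
Proof.
elim: n => [|n IHn]; first by rewrite leqn0 => /eqP ->; rewrite big_geq.
rewrite leq_eqVlt => /predU1P[->|mn]; first by rewrite big_geq ?muln1.
by rewrite big_nat_recr //= mulnA IHn // factS mulnC.
Qed.

Lemma prod_succ_fact_shift (K l n : nat) : (0 < l)%N -> (K + l <= n)%N ->
  (K.+1`! * \prod_(K + l <= i < n) (i.+2 - l) = (n.+1 - l)`!)%N.
Proof.
move=> l0 Kn; rewrite -(@prod_succ_fact K.+1 (n.+1 - l)); last by lia.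
rewrite (_ : (K + l = K.+1 + l.-1)%N); last by lia.
rewrite big_addn (_ : (n - l.-1 = n.+1 - l)%N); last by lia.
by congr (_ * _)%N; apply: eq_bigr => i _; lia.
Qed.

Lemma leq_exp_ffact (n m : nat) : (m <= n)%N -> ((n - m) ^ m <= n ^_ m)%N.
Proof.
elim: m n => [|m IHm] [|n] //; rewrite ltnS => mn.
rewrite ffactnS /= subSS expnS leq_mul ?IHm //; lia.
Qed.

(** After multiplication by K! the claim is (n+1-l)! (n+1-l)^(l-1) <= n!, true because the l - 1
    factors of n!/(n+1-l)! all exceed n+1-l. This is the case q = 1 of the bound. *)
Lemma leq_prod_exp (K l n : nat) : (0 < l)%N -> (K + l <= n)%N ->
  (K.+1 * \prod_(K + l <= i < n) (i.+2 - l) * (n.+1 - l) ^ l.-1 <=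
   \prod_(K <= i < K + l) i.+1 * \prod_(K + l <= i < n) i.+1)%N.
Proof.
move=> l0 Kn.
rewrite -(@leq_pmul2l K`!) ?fact_gt0 //.
rewrite !mulnA [(K`! * _)%N]mulnC -factS -[leqRHS]mulnA.
rewrite prod_succ_fact_shift //.
rewrite -(big_cat_nat (leq_addr l K) Kn) /= prod_succ_fact; last by lia.
rewrite -(@ffact_fact n l.-1); last by lia.
rewrite (_ : (n.+1 - l = n - l.-1)%N); last by lia.
by rewrite mulnC leq_mul2r leq_exp_ffact ?orbT //; lia.
Qed.

Lemma bernoulli_ineq (R : realType) (q : R) (n : nat) : 0 <= q <= 1 ->
  1 - n%:R * (1 - q) <= q ^+ n.
Proof.
move=> /andP[q0 q1]; elim: n => [|n IHn]; first by rewrite mul0r subr0.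
rewrite exprS; apply: le_trans (ler_wpM2l q0 IHn).
have n0 : 0 <= n%:R * ((1 - q) * (1 - q)).
  by rewrite mulr_ge0 // mulr_ge0 ?subr_ge0.
rewrite -natr1; nra.
Qed.

Lemma qint_leq (R : realType) (q : R) (n : nat) : 0 <= q <= 1 ->
  qint q n <= n%:R.
Proof.
move=> /andP[q0 q1]; rewrite -[X in X%:R]card_ord -sumr_const.
by apply: ler_sum => i _; rewrite exprn_ile1.
Qed.

(** At q = 1 the factor is (i+2-l)/(i+1). For smaller q, a <= K and Bernoulli bound the excess by
    (l-1) i (1-q)/(i+1), which i >= l makes a relative error of at most l^2 (1-q). *)
Lemma keep_factor_uniform (R : realType) (q : R) (K l a i : nat) : 0 < q <= 1 ->
  (0 < l)%N -> (K + l <= i)%N -> (a <= K)%N ->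
  keep_factor q K l a i <=
    (i.+2 - l)%:R / i.+1%:R * (1 + (l ^ 2)%:R * (1 - q)).
Proof.
move=> /andP[q0 q1] l0 Ki aK; rewrite /keep_factor.
have q01 : 0 <= q <= 1 by rewrite ltW.
have i0 : 0 < i.+1%:R :> R by rewrite ltr0n.
have h : (1 - i%:R * (1 - q)) / i.+1%:R <= q ^+ (a + (i - K)) / qint q i.+1.
  apply: (@le_trans _ _ (q ^+ i / i.+1%:R)).
    by rewrite ler_wpM2r ?invr_ge0 ?bernoulli_ineq // ltW.
  apply: ler_pM; rewrite ?exprn_ge0 ?invr_ge0 ?(ltW i0) ?(ltW q0) //.
    by rewrite ler_wiXn2l ?(ltW q0) //; lia.
  by rewrite lef_pV2 ?posrE ?qint_gt0 // qint_leq.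
apply: (@le_trans _ _ (1 - l.-1%:R * ((1 - i%:R * (1 - q)) / i.+1%:R))).
  by rewrite lerB // -mulrA ler_wpM2l.
rewrite -subr_ge0.
have -> : (i.+2 - l)%:R / i.+1%:R * (1 + (l ^ 2)%:R * (1 - q)) -
    (1 - l.-1%:R * ((1 - i%:R * (1 - q)) / i.+1%:R)) =
    (((i.+2 - l) * l ^ 2)%:R - (l.-1 * i)%:R) * (1 - q) / i.+1%:R :> R.
  have e : i.+1%:R = (i.+2 - l)%:R + l.-1%:R :> R.
    by rewrite -natrD; congr _%:R; lia.
  rewrite !natrM e; move: i0; rewrite e.
  by move/lt0r_neq0 => xy0; field.
rewrite mulr_ge0 ?invr_ge0 ?(ltW i0) // mulr_ge0 ?subr_ge0 // ler_nat.
case: l l0 Ki => // m _ Ki.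
rewrite (_ : (i.+2 - m.+1 = (i - m).+1)%N); last by lia.
have [s ->] : exists s, i = (m + s)%N by exists (i - m)%N; lia.
rewrite /= addKn -mulnn mulnCA leq_mul //; nia.
Qed.

(** The factor q^(-nl) comes from [i+1] >= (i+1) q^n in the l denominators, the last factor from the
    errors in [keep_factor_uniform]; what remains is [leq_prod_exp]. *)
Lemma mallows_cluster_le_uniform (R : realType) (q : R) (n l K : nat) :
  0 < q <= 1 -> (0 < l)%N -> (K + l <= n)%N ->
  mallows q (cluster_event n l K.+1) <=
  l`!%:R / (n.+1 - l)%:R ^+ l.-1
    * (q ^+ n) ^- l * (1 + (l ^ 2)%:R * (1 - q)) ^+ n.
Proof.
move=> q01 l0 Kn; have /andP[q0 q1] := q01.
have q01' : 0 <= q <= 1 by rewrite ltW.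
apply: le_trans (mallows_cluster_le q01 l0 Kn) _.
set A := 1 + _.
have A1 : 1 <= A by rewrite /A lerDl mulr_ge0 ?subr_ge0.
(* Values at q = 1: [P1] of the denominators, P2 / P3 of the product of keep factors. *)
pose P1 : R := (\prod_(K <= i < K + l) i.+1)%:R.
pose P2 : R := (\prod_(K + l <= i < n) (i.+2 - l))%:R.
pose P3 : R := (\prod_(K + l <= i < n) i.+1)%:R.
have P10 : 0 < P1 by rewrite ltr0n prodn_gt0.
have P30 : 0 < P3 by rewrite ltr0n prodn_gt0.
have h1 : P1 * (q ^+ n) ^+ l <= \prod_(K <= i < K + l) qint q i.+1.
  rewrite /P1 natr_prod.
  have -> : (q ^+ n) ^+ l = \prod_(K <= i < K + l) q ^+ n.
    by rewrite prodr_const_nat addKn.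
  rewrite -big_split /= !big_nat; apply: ler_prod => i /andP[_ ii].
  rewrite mulr_ge0 ?exprn_ge0 ?(ltW q0) //=.
  apply: le_trans (qint_lower q01' (leqnn _)).
  by rewrite ler_wpM2l // ler_wiXn2l ?(ltW q0) //; lia.
have h2 (a : 'I_K.+1) :
    q ^+ (a * l) * \prod_(K + l <= i < n) keep_factor q K l a i <=
    P2 / P3 * A ^+ n.
  rewrite -[leRHS]mul1r; apply: ler_pM.
  - by rewrite exprn_ge0 // ltW.
  - rewrite big_nat prodr_ge0 // => i /andP[ii _]; exact: keep_factor_ge0.
  - by rewrite exprn_ile1 // ltW.
  apply: (@le_trans _ _ (P2 / P3 * A ^+ (n - (K + l)))); last first.
    by rewrite ler_wpM2l ?divr_ge0 ?(ltW P30) ?ler_weXn2l ?leq_subr // ler0n.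
  rewrite /P2 /P3 !natr_prod -prodf_div -prodr_const_nat -big_split /= !big_nat.
  apply: ler_prod => i /andP[ii _]; rewrite keep_factor_ge0 //=.
  by apply: keep_factor_uniform => //; rewrite -ltnS.
have h3 : \sum_(a < K.+1)
    (q ^+ (a * l) * \prod_(K + l <= i < n) keep_factor q K l a i)
    <= K.+1%:R * (P2 / P3 * A ^+ n).
  rewrite mulr_natl -[X in _ *+ X]card_ord -sumr_const.
  exact: ler_sum.
have Q0 : 0 < \prod_(K <= i < K + l) qint q i.+1.
  by apply: prodr_gt0 => i _; rewrite qint_gt0.
have Ql0 : 0 < (q ^+ n) ^+ l by rewrite !exprn_gt0.
apply: (@le_trans _ _ (l`!%:R / (P1 * (q ^+ n) ^+ l) *
    (K.+1%:R * (P2 / P3 * A ^+ n)))).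
  apply: ler_pM => //.
  - by rewrite divr_ge0 // ltW.
  - apply: sumr_ge0 => a _; rewrite mulr_ge0 ?exprn_ge0 ?(ltW q0) //.
    rewrite big_nat prodr_ge0 // => i /andP[ii _]; exact: keep_factor_ge0.
  - by rewrite ler_wpM2l // lef_pV2 ?posrE ?mulr_gt0.
have h4 : K.+1%:R * P2 / (P1 * P3) <= (n.+1 - l)%:R ^- l.-1.
  have nl0 : 0 < (n.+1 - l)%:R ^+ l.-1 :> R.
    by rewrite exprn_gt0 // ltr0n subn_gt0 ltnS (leq_trans (leq_addl K l)).
  rewrite ler_pdivrMr ?mulr_gt0 // [leRHS]mulrC ler_pdivlMr // /P1 /P2 /P3.
  by rewrite -natrX -!natrM ler_nat leq_prod_exp.
have A0 : 0 <= A ^+ n by rewrite exprn_ge0 // (le_trans _ A1).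
have -> : l`!%:R / (P1 * (q ^+ n) ^+ l) * (K.+1%:R * (P2 / P3 * A ^+ n))
   = (K.+1%:R * P2 / (P1 * P3)) * (l`!%:R * ((q ^+ n) ^- l * A ^+ n)).
  rewrite !invfM; move: (A ^+ n) ((q ^+ n) ^- l) => x y; ring.
apply: le_trans (ler_wpM2r _ h4) _.
  by rewrite mulr_ge0 // mulr_ge0 // invr_ge0 ltW.
by rewrite le_eqVlt; apply/orP; left; apply/eqP; ring.
Qed.

Local Open Scope classical_set_scope.
Local Open Scope ring_scope.

(** * Asymptotics for 1 - q = o(1/n) *)

Lemma asymp_le_near (R : realType) (a b w : nat -> R) :
  (\forall n \near \oo, a n / b n <= w n) -> w n @[n --> \oo] --> (1 : R) ->
  asymp_le a b.
Proof.
move=> hw w1; apply/lee_addgt0Pr => e e0.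
have he : \forall n \near \oo, a n / b n <= 1 + e.
  have w1e : \forall n \near \oo, w n <= 1 + e.
    by apply: cvgr_le w1 _ _; rewrite ltrDl.
  by near=> n; apply: (@le_trans _ _ (w n)); near: n.
(* The limsup is an infimum of suprema over sets of the filter; by [he] this set is one of them. *)
apply: (@le_trans _ _ (ereal_sup
  [set (a n / b n)%:E | n in [set n | a n / b n <= 1 + e]])).
  by apply: ereal_inf_lbound; exists [set n | a n / b n <= 1 + e].
by apply: ge_ereal_sup => _ [n /= hn <-]; rewrite lee_fin.
Unshelve. all: by end_near.
Qed.

Lemma cvg_exprn (R : realType) (f : nat -> R) (a : R) (m : nat) :
  f n @[n --> \oo] --> a -> f n ^+ m @[n --> \oo] --> a ^+ m.
Proof. by move=> fa; exact: (cvg_comp _ _ fa (@exprn_continuous R m a)). Qed.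

Lemma cvg_expR (R : realType) (f : nat -> R) (a : R) :
  f n @[n --> \oo] --> a -> expR (f n) @[n --> \oo] --> expR a.
Proof. by move=> fa; exact: (cvg_comp _ _ fa (@continuous_expR R a)). Qed.

Lemma cvg_divn (R : realType) (x : R) : x / n%:R @[n --> \oo] --> (0 : R).
Proof.
rewrite -[X in _ --> X](mulr0 x); apply: cvgM; first exact: cvg_cst.
apply/gtr0_cvgV0; last exact: cvgr_idn.
by near=> n; rewrite ltr0n; near: n; exact: nbhs_infty_gt.
Unshelve. all: by end_near.
Qed.

Lemma asymp_le_mallows_uniform (R : realType) (l : nat) (q : nat -> R)
    (k : nat -> nat) :
  (2 <= l)%N ->
  (forall n, (0 < n)%N -> q n < 1) ->
  (fun n => 1 - q n) =o_\oo (fun n => n%:R^-1 : R) ->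
  (forall n, (l <= n)%N -> (1 <= k n <= n - l + 1)%N) ->
  asymp_le
    (fun n => mallows (q n) (cluster_event n l (k n)))
    (fun n => (l`!)%:R / n%:R ^+ (l - 1)).
Proof.
move=> l2 q1 qo hk; have l0 : (0 < l)%N by exact: ltnW.
have d0 : n%:R * (1 - q n) @[n --> \oo] --> (0 : R).
  apply/cvgr0Pnorm_le => e e0.
  have /eqoP/(_ _ e0) h := qo.
  near=> n.
  have n0 : 0 < n%:R :> R by rewrite ltr0n; near: n; exact: nbhs_infty_gt.
  rewrite normrM (ger0_norm (ltW n0)) mulrC -ler_pdivlMr //.
  rewrite -[X in _ / X](ger0_norm (ltW n0)) -normfV; near: n; exact: h.
(* The factors account for (n/(n+1-l))^(l-1), for q^(-nl) by Bernoulli, and for (1 + l^2 (1-q))^n by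
   1 + x <= exp x. *)
pose w n : R := (1 - (l - 1)%:R / n%:R) ^- (l - 1) * (1 - n%:R * (1 - q n)) ^- l
  * expR ((l ^ 2)%:R * (n%:R * (1 - q n))).
apply: (@asymp_le_near _ _ _ w).
  near=> n.
  have ln : (l <= n)%N by near: n; exact: nbhs_infty_ge.
  have n0 : (0 < n)%N by lia.
  have nR0 : 0 < n%:R :> R by rewrite ltr0n.
  have qd : n%:R * (1 - q n) < 1 by near: n; apply: cvgr_lt d0 _ _.
  (* If q <= 0 and n >= 1, then n (1 - q) is at least 1, against [qd]. *)
  have q0 : 0 < q n.
    rewrite -subr_gt0 in qd; apply: contraTT qd; rewrite -!leNgt => qn.
    have : 1 <= n%:R :> R by rewrite ler1n.
    nra.
  have q01 : 0 < q n <= 1 by rewrite q0 ltW ?q1.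
  have [k1 k2] := andP (hk n ln).
  have := mallows_cluster_le_uniform (l := l) (K := (k n).-1) (n := n) q01 l0.
  rewrite prednK // => /(_ _)/le_trans; rewrite ler_pdivrMr; last first.
    by rewrite divr_gt0 ?exprn_gt0 // ltr0n fact_gt0.
  apply; first by lia.
  have -> : w n * (l`!%:R / n%:R ^+ (l - 1)) = l`!%:R / (n.+1 - l)%:R ^+ l.-1 *
     (1 - n%:R * (1 - q n)) ^- l * expR ((l ^ 2)%:R * (n%:R * (1 - q n))).
    rewrite /w subn1.
    have -> : (n.+1 - l)%:R = n%:R * (1 - (l.-1)%:R / n%:R) :> R.
      rewrite mulrBr mulr1 mulrCA divff ?gt_eqF // mulr1 -natrB; last by lia.
      by congr _%:R; lia.
    rewrite exprMn invfM.
    by move: (_ ^- l.-1) (_ ^- l) (n%:R ^- l.-1) (expR _) => x y z t; ring.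
  have qn1 : 0 < 1 - n%:R * (1 - q n) by rewrite subr_gt0.
  have le1 : 1 - n%:R * (1 - q n) <= q n ^+ n.
    by apply: bernoulli_ineq; rewrite !ltW ?q1.
  have d1 : 0 <= (l ^ 2)%:R * (1 - q n) by rewrite mulr_ge0 // subr_ge0 ltW ?q1.
  apply: ler_pM.
  - by rewrite !mulr_ge0 ?invr_ge0 ?exprn_ge0 ?exprn_ge0 ?(ltW q0).
  - by rewrite exprn_ge0 // addr_ge0.
  - rewrite ler_wpM2l ?divr_ge0 ?exprn_ge0 //.
    by rewrite lef_pV2 ?posrE ?exprn_gt0 // lerXn2r // nnegrE ?exprn_ge0 // ltW.
  - rewrite mulrCA expRM_natl lerXn2r ?nnegrE ?expR_ge0 ?addr_ge0 //.
    exact: expR_ge1Dx.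
have c1 : 1 - (l - 1)%:R / n%:R @[n --> \oo] --> (1 - 0 : R).
  by apply: cvgB; [exact: cvg_cst|exact: cvg_divn].
have c2 : 1 - n%:R * (1 - q n) @[n --> \oo] --> (1 - 0 : R).
  by apply: cvgB; [exact: cvg_cst|].
have c3 : (l ^ 2)%:R * (n%:R * (1 - q n)) @[n --> \oo] --> ((l ^ 2)%:R * 0 : R).
  by apply: cvgM; [exact: cvg_cst|].
have u1 m : (1 - 0 : R) ^+ m != 0 by rewrite subr0 expr1n oner_neq0.
have := cvgM (cvgM (cvgV (u1 _) (cvg_exprn (m := l - 1) c1))
  (cvgV (u1 _) (cvg_exprn (m := l) c2))) (cvg_expR c3).
rewrite mulr0 expR0 subr0 !expr1n invr1 !mulr1; exact.
Unshelve. all: by end_near.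
Qed.

(** * Asymptotics for q = 1 - c/n *)

Lemma qint_geom (R : realType) (q : R) (n : nat) : q != 1 ->
  qint q n = (1 - q ^+ n) / (1 - q).
Proof.
move=> q1; have h : 1 - q != 0 by rewrite subr_eq0 eq_sym.
apply: (mulIf h); rewrite divfK //.
by rewrite -[1 - _ ^+ _]opprB subrX1 mulrC -mulNr opprB.
Qed.

(** The quotient of the two arguments is 1 + q^(i+1)/[i+1], and ln (1 + x) <= x. The terms of the
    exponent are thus bounded below by differences that telescope. *)
Lemma ln_succ_le (R : realType) (q : R) (i : nat) : 0 < q < 1 ->
  ln (1 - q ^+ i.+2) - ln (1 - q ^+ i.+1) <= q ^+ i / qint q i.+1.
Proof.
move=> /andP[q0 q1]; have h j : 0 < 1 - q ^+ j.+1.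
  by rewrite subr_gt0 exprn_ilt1 // ltW.
have q1' : 0 < 1 - q by rewrite subr_gt0.
rewrite -ln_div ?posrE // qint_geom ?lt_eqF //.
have -> : (1 - q ^+ i.+2) / (1 - q ^+ i.+1) =
    1 + q ^+ i.+1 * (1 - q) / (1 - q ^+ i.+1).
  by rewrite [q ^+ i.+2]exprS; field; rewrite gt_eqF.
have x0 : 0 <= q ^+ i.+1 * (1 - q) / (1 - q ^+ i.+1).
  by rewrite !mulr_ge0 ?invr_ge0 ?exprn_ge0 ?ltW.
apply: le_trans (le_ln1Dx _) _; first by rewrite (lt_le_trans _ x0) // ltrN10.
rewrite invf_div mulrA ler_wpM2r ?invr_ge0 ?(ltW (h _)) //.
by rewrite ler_wpM2r ?(ltW q1') // ler_wiXn2l ?(ltW q0) ?(ltW q1).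
Qed.

(** By 1 - x <= exp(-x) and [ln_succ_le], each factor has exponent at most -(l-1) q^(a-K) times a
    difference of logarithms, and these telescope from K + l to n. *)
Lemma prod_keep_factor_le (R : realType) (q : R) (K l a n : nat) : 0 < q < 1 ->
  (0 < l)%N -> (K + l <= n)%N ->
  \prod_(K + l <= i < n) keep_factor q K l a i <=
  expR (- (l.-1%:R / q ^+ K * ln ((1 - q ^+ n.+1) / (1 - q ^+ (K + l).+1)))
        * q ^+ a).
Proof.
move=> q01 l0 Kn; have /andP[q0 q1] := q01.
have h j : 0 < 1 - q ^+ j.+1 by rewrite subr_gt0 exprn_ilt1 // ltW.
pose B := l.-1%:R / q ^+ K * q ^+ a.
have B0 : 0 <= B by rewrite !mulr_ge0 ?invr_ge0 ?exprn_ge0 ?(ltW q0).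
apply: (@le_trans _ _ (\prod_(K + l <= i < n)
    expR (- B * (ln (1 - q ^+ i.+2) - ln (1 - q ^+ i.+1))))).
  rewrite !big_nat; apply: ler_prod => i /andP[Ki _].
  rewrite keep_factor_ge0 ?q0 ?(ltW q1) //=.
  apply: le_trans (expR_ge1Dx _).
  rewrite /keep_factor lerD2l mulNr lerN2.
  apply: le_trans (ler_wpM2l B0 (ln_succ_le i q01)) _.
  have -> : q ^+ (a + (i - K)) = q ^+ a * (q ^+ i / q ^+ K).
    have qK : q ^+ K != 0 by rewrite expf_neq0 // gt_eqF.
    rewrite exprD; congr (_ * _); apply: (mulIf qK).
    rewrite divfK // -exprD subnK //; exact: leq_trans (leq_addr _ _) Ki.
  by rewrite /B le_eqVlt; apply/orP; left; apply/eqP; ring.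
rewrite -expR_sum -mulr_sumr (telescope_sumr (fun i => ln (1 - q ^+ i.+1))) //.
rewrite -ln_div ?posrE // /B ler_expR le_eqVlt.
by apply/orP; left; apply/eqP; ring.
Qed.

(** * Integrals over segments and the Riemann sum on the geometric grid *)

Lemma continuous_integrable_itv (R : realType) (g : R -> R) (a b : R) :
  continuous g ->
  lebesgue_measure.-integrable `[a, b] (EFin \o g).
Proof.
move=> gc; apply: continuous_compact_integrable; first exact: segment_compact.
exact: continuous_subspaceT.
Qed.

Lemma Rintegral_split (R : realType) (g : R -> R) (a x b : R) :
  continuous g -> a <= x -> x <= b ->
  \int[lebesgue_measure]_(y in `[a, b]) g y =
  \int[lebesgue_measure]_(y in `[a, x]) g y +
  \int[lebesgue_measure]_(y in `[x, b]) g y.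
Proof.
move=> gc ax xb; apply/eqP; rewrite addrC -subr_eq; apply/eqP.
rewrite Rintegral_itvB ?bnd_simp //; last exact: continuous_integrable_itv.
apply: Rintegral_itv_obnd_cbnd.
apply: integrableS (continuous_integrable_itv x b gc) => //.
by apply: subset_itvr; rewrite bnd_simp.
Qed.

Lemma Rintegral_cst_itv (R : realType) (a b r : R) : a <= b ->
  \int[lebesgue_measure]_(y in `[a, b]) r = r * (b - a).
Proof.
move=> ab; rewrite Rintegral_cst //= lebesgue_measure_itv /= lte_fin.
case: ltP => //= ba; rewrite (_ : a = b) ?subrr ?mulr0 //.
exact/le_anti/andP.
Qed.

Lemma Rintegral_itv_ge (R : realType) (g : R -> R) (a b r : R) :
  continuous g -> a <= b ->
  (forall y, a <= y <= b -> r <= g y) ->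
  r * (b - a) <= \int[lebesgue_measure]_(y in `[a, b]) g y.
Proof.
move=> gc ab h; rewrite -Rintegral_cst_itv //; apply: le_Rintegral => //.
- apply: continuous_compact_integrable; first exact: segment_compact.
  by apply: continuous_subspaceT => x; exact: cvg_cst.
- exact: continuous_integrable_itv.
Qed.

Lemma Rintegral_itv_le (R : realType) (g : R -> R) (a b r : R) :
  continuous g -> a <= b ->
  (forall y, a <= y <= b -> g y <= r) ->
  \int[lebesgue_measure]_(y in `[a, b]) g y <= r * (b - a).
Proof.
move=> gc ab h; rewrite -Rintegral_cst_itv //; apply: le_Rintegral => //.
- exact: continuous_integrable_itv.
- apply: continuous_compact_integrable; first exact: segment_compact.
  by apply: continuous_subspaceT => x; exact: cvg_cst.
Qed.

(** The integrand of the limit, with m = l - 1 and [b] the coefficient of y in the exponential. *)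
Definition pow_exp (R : realType) (m : nat) (b y : R) : R :=
  y ^+ m * expR (b * y).

Lemma pow_exp_continuous (R : realType) (m : nat) (b : R) :
  continuous (pow_exp m b).
Proof.
move=> x; apply: cvgM; first exact: exprn_continuous.
apply: (cvg_comp (fun y : R => b * y) (@expR R)); last exact: continuous_expR.
by apply: cvgM; [exact: cvg_cst|exact: cvg_id].
Qed.

Lemma pow_exp_ge0 (R : realType) (m : nat) (b y : R) :
  0 <= y -> 0 <= pow_exp m b y.
Proof. by move=> y0; rewrite mulr_ge0 ?exprn_ge0 ?expR_ge0. Qed.

Lemma pow_exp_le1 (R : realType) (m : nat) (b y : R) : b <= 0 -> 0 <= y <= 1 ->
  pow_exp m b y <= 1.
Proof.
move=> b0 /andP[y0 y1]; rewrite mulr_ile1 ?exprn_ge0 ?expR_ge0 ?exprn_ile1 //.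
by rewrite expR_le1 mulr_le0_ge0.
Qed.

(* [q ^- m] pays for replacing y by q^a on [q^(a+1), q^a] in the factor y^m. *)
Lemma geometric_riemann_le (R : realType) (q b : R) (m n : nat) :
  0 < q < 1 -> b <= 0 ->
  \sum_(a < n) (1 - q) * (q ^+ a * pow_exp m b (q ^+ a)) <=
  q ^- m * \int[lebesgue_measure]_(y in `[q ^+ n, 1]) pow_exp m b y.
Proof.
move=> /andP[q0 q1] b0; elim: n => [|n IHn].
  rewrite big_ord0 mulr_ge0 ?invr_ge0 ?exprn_ge0 ?(ltW q0) //.
  apply: Rintegral_ge0 => y /=; rewrite in_itv /= => /andP[y1 _].
  by rewrite pow_exp_ge0 // (le_trans _ y1).
have qm : q ^+ m != 0 by rewrite expf_neq0 // gt_eqF.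
have qn0 : 0 < q ^+ n by rewrite exprn_gt0.
have qnS : q ^+ n.+1 <= q ^+ n by rewrite ler_wiXn2l ?ltW.
rewrite big_ord_recr /= (Rintegral_split (pow_exp_continuous (b := b)) qnS).
  2: by rewrite exprn_ile1 ?ltW.
rewrite mulrDr addrC lerD //.
have h : q ^+ m * pow_exp m b (q ^+ n) * (q ^+ n - q ^+ n.+1) <=
    \int[lebesgue_measure]_(y in `[q ^+ n.+1, q ^+ n]) pow_exp m b y.
  apply: Rintegral_itv_ge; [exact: pow_exp_continuous|done|] => y /andP[y1 y2].
  have qS0 : 0 <= q ^+ n.+1 by rewrite exprn_ge0 // ltW.
  rewrite /pow_exp mulrA -exprMn -exprS.
  apply: ler_pM; rewrite ?exprn_ge0 ?expR_ge0 ?(ltW q0) //.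
    by rewrite lerXn2r // nnegrE ?exprn_ge0 ?(ltW q0) // (le_trans qS0).
  by rewrite ler_expR ler_wnM2l.
apply: le_trans (ler_wpM2l _ h); last by rewrite invr_ge0 exprn_ge0 // ltW.
rewrite !mulrA mulVf // mul1r exprS le_eqVlt; apply/orP; left; apply/eqP; ring.
Qed.

(** A fixed [b] replaces the varying -B at the price exp|b + B|, so that the integrand does not
    change with n. The denominators are at least [K+1]^l, and one of the resulting l factors 1 - q
    becomes the mesh of the grid q^a. *)
Lemma mallows_cluster_le_integral (R : realType) (q b B : R) (n l K : nat) :
  0 < q < 1 -> b <= 0 -> (0 < l)%N -> (K + l <= n)%N ->
  B = l.-1%:R / q ^+ K * ln ((1 - q ^+ n.+1) / (1 - q ^+ (K + l).+1)) ->
  mallows q (cluster_event n l K.+1) <=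
  l`!%:R * (1 - q) ^+ l.-1 / (1 - q ^+ K.+1) ^+ l *
  (expR `|b + B| * (q ^- l.-1 *
     \int[lebesgue_measure]_(y in `[q ^+ K.+1, 1]) pow_exp l.-1 b y)).
Proof.
move=> q01 b0 l0 Kn BE; have /andP[q0 q1] := q01.
have q01' : 0 < q <= 1 by rewrite q0 ltW.
have d0 : 0 < 1 - q by rewrite subr_gt0.
have dK : 0 < 1 - q ^+ K.+1 by rewrite subr_gt0 exprn_ilt1 // ltW.
apply: le_trans (mallows_cluster_le q01' l0 Kn) _.
have hQ : ((1 - q ^+ K.+1) / (1 - q)) ^+ l <=
    \prod_(K <= i < K + l) qint q i.+1.
  rewrite -qint_geom ?lt_eqF //.
  have -> : qint q K.+1 ^+ l = \prod_(K <= i < K + l) qint q K.+1.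
    by rewrite prodr_const_nat addKn.
  rewrite !big_nat.
  apply: ler_prod => i /andP[Ki _]; rewrite qint_ge0 ?(ltW q0) //=.
  by rewrite leq_qint ?(ltW q0).
apply: (@le_trans _ _ (l`!%:R * ((1 - q) / (1 - q ^+ K.+1)) ^+ l *
  (expR `|b + B| * \sum_(a < K.+1) (q ^+ a * pow_exp l.-1 b (q ^+ a))))).
  apply: ler_pM.
  - rewrite divr_ge0 // prodr_ge0 // => i _; exact/qint_ge0/ltW.
  - apply: sumr_ge0 => a _; rewrite mulr_ge0 ?exprn_ge0 ?(ltW q0) //.
    rewrite big_nat prodr_ge0 // => i /andP[ii _]; exact: keep_factor_ge0.
  - rewrite ler_wpM2l // -[(1 - q) / _]invf_div exprVn lef_pV2 // posrE.
      by apply: prodr_gt0 => i _; rewrite qint_gt0.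
    by rewrite exprn_gt0 // divr_gt0.
  rewrite mulr_sumr; apply: ler_sum => a _.
  have qa0 : 0 <= q ^+ a by rewrite exprn_ge0 // ltW.
  have qa1 : q ^+ a <= 1 by rewrite exprn_ile1 // ltW.
  apply: le_trans (ler_wpM2l _ (prod_keep_factor_le a q01 l0 Kn)) _.
    by rewrite exprn_ge0 // ltW.
  rewrite -BE exprM -[in X in X <= _](prednK l0) exprS /pow_exp.
  rewrite [leRHS]mulrCA -[leLHS]mulrA ler_wpM2l // [leRHS]mulrCA.
  rewrite ler_wpM2l ?exprn_ge0 ?(ltW q0) //.
  rewrite -expRD ler_expR.
  (* exp(-B y) = exp(b y) exp(-(b + B) y), here with y = q^a in [0, 1]. *)
  have : - ((b + B) * q ^+ a) <= `|b + B|.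
    apply: le_trans (ler_norm _) _; rewrite normrN normrM -[leRHS]mulr1.
    by rewrite ler_wpM2l // ger0_norm.
  lra.
have := ler_wpM2l (expR_ge0 `|b + B|) (geometric_riemann_le l.-1 K.+1 q01 b0).
rewrite -mulr_sumr => h.
have -> : l`!%:R * (1 - q) ^+ l.-1 / (1 - q ^+ K.+1) ^+ l =
    l`!%:R * ((1 - q) / (1 - q ^+ K.+1)) ^+ l / (1 - q).
  have e : (1 - q) ^+ l = (1 - q) * (1 - q) ^+ l.-1 by rewrite -exprS prednK.
  rewrite expr_div_n e.
  by field; rewrite expf_neq0 ?(gt_eqF dK) ?(gt_eqF d0).
rewrite -[leRHS]mulrA; apply: ler_wpM2l.
  by rewrite mulr_ge0 // exprn_ge0 // divr_ge0 ?(ltW d0) ?(ltW dK).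
rewrite ler_pdivlMl //; apply: le_trans h.
by rewrite mulrCA.
Qed.

(** * Passage to the limit for q = 1 - c/n *)

Lemma near_divn_lt (R : realType) (c e : R) : 0 < e ->
  \forall n \near \oo, c / n%:R < e.
Proof. by move=> e0; apply: cvgr_lt (cvg_divn c) _ _. Qed.

(** With u = c/n < 1, exp(-u/(1-u)) <= 1 - u <= exp(-u); raised to the power [j n], both outer terms
    have the same limit. *)
Lemma cvg_expr_near1 (R : realType) (c x : R) (j : nat -> nat) : 0 < c ->
  (j n)%:R / n%:R @[n --> \oo] --> x ->
  (1 - c / n%:R) ^+ j n @[n --> \oo] --> expR (- (c * x)).
Proof.
move=> c0 jx.
pose lo n : R := expR (- (c * ((j n)%:R / n%:R) / (1 - c / n%:R))).
pose up n : R := expR (- (c * ((j n)%:R / n%:R))).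
have cj : c * ((j n)%:R / n%:R) @[n --> \oo] --> c * x.
  by apply: cvgM => //; exact: cvg_cst.
have c1 : 1 - c / n%:R @[n --> \oo] --> (1 - 0 : R).
  by apply: cvgB; [exact: cvg_cst|exact: cvg_divn].
apply: (@squeeze_cvgr _ _ _ _ lo up).
- near=> n.
  have u1 : c / n%:R < 1 by near: n; exact: near_divn_lt.
  have u0 : 0 <= c / n%:R by rewrite divr_ge0 // ltW.
  set u := c / n%:R in u1 u0 *.
  have v0 : 0 < 1 - u by rewrite subr_gt0.
  have -> : lo n = expR (- (u / (1 - u))) ^+ j n.
    by rewrite -expRM_natl /lo -/u; congr expR; rewrite /u; ring.
  have -> : up n = expR (- u) ^+ j n.
    by rewrite -expRM_natl /up; congr expR; rewrite /u; ring.
  apply/andP; split; rewrite lerXn2r ?nnegrE ?expR_ge0 ?(ltW v0) //; last first.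
    exact: expR_ge1Dx.
  rewrite expRN -[leRHS]invrK lef_pV2 ?posrE ?expR_gt0 ?invr_gt0 //.
  apply: le_trans (expR_ge1Dx _).
  by rewrite le_eqVlt; apply/orP; left; apply/eqP; field; rewrite gt_eqF.
- have := cvg_expR (cvgN (cvgM cj (cvgV _ c1))).
  by rewrite subr0 invr1 mulr1; apply; exact: oner_neq0.
- exact: cvg_expR (cvgN cj).
Unshelve. all: by end_near.
Qed.

(** The integrand lies in [0, 1] because b <= 0. This makes the integral converge when its lower end
    q^k does. *)
Lemma Rintegral_pow_exp_lipschitz (R : realType) (m : nat) (b x y : R) :
  b <= 0 -> 0 <= x <= 1 -> 0 <= y <= 1 ->
  `|\int[lebesgue_measure]_(t in `[x, 1]) pow_exp m b t -
    \int[lebesgue_measure]_(t in `[y, 1]) pow_exp m b t| <= `|x - y|.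
Proof.
move=> b0; wlog xy : x y / x <= y => [h x01 y01|].
  have [xy|yx] := leP x y; first exact: h.
  by rewrite distrC [leRHS]distrC; apply: h => //; exact: ltW.
move=> /andP[x0 x1] /andP[y0 y1].
rewrite (Rintegral_split (pow_exp_continuous (b := b)) xy y1) addrK distrC.
rewrite ger0_norm; last first.
  apply: Rintegral_ge0 => t /=; rewrite in_itv /= => /andP[t1 _].
  by rewrite pow_exp_ge0 // (le_trans x0).
rewrite ger0_norm ?subr_ge0 // -[leRHS]mul1r.
apply: Rintegral_itv_le; [exact: pow_exp_continuous|done|] => t /andP[t1 t2].
by rewrite pow_exp_le1 // (le_trans x0) //= (le_trans t2).
Qed.

(** The integrand is at least x^m exp b on the segment. Positivity lets the integral stand as a
    denominator in the limiting ratio. *)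
Lemma Rintegral_pow_exp_gt0 (R : realType) (m : nat) (b x : R) :
  b <= 0 -> 0 < x < 1 ->
  0 < \int[lebesgue_measure]_(t in `[x, 1]) pow_exp m b t.
Proof.
move=> b0 /andP[x0 x1].
apply: (@lt_le_trans _ _ (x ^+ m * expR b * (1 - x))).
  by rewrite !mulr_gt0 ?exprn_gt0 ?expR_gt0 ?subr_gt0.
apply: Rintegral_itv_ge => [||t /andP[t1 t2]]; [|exact: ltW|].
  exact: pow_exp_continuous.
rewrite /pow_exp; apply: ler_pM; rewrite ?exprn_ge0 ?expR_ge0 ?(ltW x0) //.
  by rewrite lerXn2r // nnegrE ?(ltW x0) // (le_trans _ t1) // ltW.
by rewrite ler_expR -[leLHS]mulr1 ler_wnM2l.
Qed.

(** [X] and [IX] are the values at n of q^k and of the integral, [x] and [Ix] their limits; [L] is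
    l! and [N] is n. The right side isolates the claimed rate, and the factors before it tend to
    1. *)
Lemma rate_identity (R : realType) (l m : nat) (L c N E Q x X Ix IX : R) :
  N != 0 -> Q != 0 -> 1 - x != 0 -> 1 - X != 0 -> Ix != 0 ->
  L * (c / N) ^+ m / (1 - X) ^+ l * (E * (Q^-1 * IX)) =
  E * Q^-1 * (IX / Ix) * ((1 - x) / (1 - X)) ^+ l
    * (1 / (1 - x) ^+ l * Ix * (c ^+ m * L / N ^+ m)).
Proof.
move=> N0 Q0 x0 X0 I0; rewrite !expr_div_n; field.
by rewrite !expf_neq0 ?Q0 ?I0.
Qed.

Lemma asymp_le_mallows_linear (R : realType) (l : nat) (c d : R)
    (k : nat -> nat) :
  (2 <= l)%N -> 0 < c -> 0 < d < 1 ->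
  asymp_equiv (fun n => (k n)%:R) (fun n => d * n%:R) ->
  asymp_le
    (fun n => mallows (1 - c / n%:R) (cluster_event n l (k n)))
    (fun n =>
       1 / (1 - expR (- (c * d))) ^+ l
       * (\int[lebesgue_measure]_(y in `[expR (- (c * d)), 1])
            pow_exp (l - 1) (ln ((1 - expR (- (c * d))) / (1 - expR (- c)))
                        * expR (c * d) * (l - 1)%:R) y)
       * (c ^+ (l - 1) * (l`!)%:R / n%:R ^+ (l - 1))).
Proof.
move=> l2 c0 /andP[d0 d1] kdn; have l0 : (0 < l)%N by exact: ltnW.
have kd : (k n)%:R / n%:R @[n --> \oo] --> d.
  have -> : (fun n => (k n)%:R / n%:R) = (fun n => (k n)%:R / (d * n%:R) * d).
    by apply/funext => n; rewrite invfM mulrA mulrAC divfK ?gt_eqF.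
  by rewrite -[X in _ --> X]mul1r; apply: cvgM => //; exact: cvg_cst.
(* [x] and [e] are the limits of q^k and q^n. *)
set x := expR (- (c * d)); set e := expR (- c); set b := ln _ * _ * _.
set I := fun t => \int[lebesgue_measure]_(y in `[t, 1]) pow_exp (l - 1) b y.
have x0 : 0 < x by exact: expR_gt0.
have x1 : x < 1 by rewrite expR_lt1 oppr_lt0 mulr_gt0.
have e1 : e < 1 by rewrite expR_lt1 oppr_lt0.
have ex : e <= x by rewrite ler_expR lerN2 -[leRHS]mulr1 ler_wpM2l ?ltW.
have dx : 0 < 1 - x by rewrite subr_gt0.
have de : 0 < 1 - e by rewrite subr_gt0.
have b0 : b <= 0.
  rewrite /b mulr_le0_ge0 // mulr_le0_ge0 ?expR_ge0 //.
  by rewrite ln_le0 // ler_pdivrMr // mul1r lerD2l lerN2.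
have Ix0 : 0 < I x by apply: Rintegral_pow_exp_gt0; rewrite // x0.
pose q n : R := 1 - c / n%:R.
pose X n : R := q n ^+ k n.
pose Y n : R := q n ^+ n.
(* The [B] of [mallows_cluster_le_integral] for K = k - 1, whence q^K = X/q, q^(n+1) = Y q and
   q^(K+l+1) = X q^l. *)
pose B n : R := l.-1%:R / (X n / q n) *
  ln ((1 - Y n * q n) / (1 - X n * q n ^+ l)).
have q_lim : q n @[n --> \oo] --> (1 : R).
  have : 1 - c / n%:R @[n --> \oo] --> (1 - 0 : R).
    by apply: cvgB; [exact: cvg_cst|exact: cvg_divn].
  by rewrite subr0; exact.
have X_lim : X n @[n --> \oo] --> x by exact: cvg_expr_near1.
have Y_lim : Y n @[n --> \oo] --> e.
  rewrite /e -[c in expR (- c)]mulr1; apply: (@cvg_expr_near1 _ _ _ id) => //.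
  apply: cvg_near_cst; near=> n.
  by rewrite divff // pnatr_eq0 -lt0n; near: n; exact: nbhs_infty_gt.
have I_lim : I (X n) @[n --> \oo] --> I x.
  apply/cvgrPdist_le => r r0.
  have h := (cvgrPdist_le _ _).1 X_lim r r0.
  near=> n.
  have X1 : X n < 1 by near: n; apply: cvgr_lt X_lim _ _.
  have X0 : 0 < X n by near: n; apply: cvgr_gt X_lim _ _.
  apply: le_trans (Rintegral_pow_exp_lipschitz _ b0 _ _) _.
  1,2: by rewrite !ltW.
  by near: n; exact: h.
(* The sign is that of ln under inversion of its argument; so b + B tends to 0 and exp|b + B| to
   1. *)
have B_lim : B n @[n --> \oo] --> - b.
  have -> : - b = l.-1%:R / (x / 1) * ln ((1 - e * 1) / (1 - x * 1 ^+ l)).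
    rewrite expr1n !mulr1 divr1 -[(1 - e) / _]invf_div lnV ?posrE ?divr_gt0 //.
    by rewrite /b -[in RHS]/x [x]expRN invrK subn1; ring.
  apply: cvgM.
    apply: cvgM; first exact: cvg_cst.
    apply: cvgV; first by rewrite divr1 gt_eqF.
    by apply: cvgM => //; apply: cvgV => //; exact: oner_neq0.
  apply: (cvg_comp _ (@ln R)); last first.
    by apply: continuous_ln; rewrite expr1n !mulr1 divr_gt0.
  apply: cvgM; last apply: cvgV.
  - by apply: cvgB; [exact: cvg_cst|exact: cvgM].
  - by rewrite expr1n mulr1 gt_eqF.
  - by apply: cvgB; [exact: cvg_cst|apply: cvgM => //; exact: cvg_exprn].
pose w n : R := expR `|b + B n| * q n ^- (l - 1) * (I (X n) / I x)
  * ((1 - x) / (1 - X n)) ^+ l.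
apply: (@asymp_le_near _ _ _ w).
  near=> n.
  have n0 : (0 < n)%N by near: n; exact: nbhs_infty_gt.
  have nR0 : 0 < n%:R :> R by rewrite ltr0n.
  have q1 : q n < 1 by rewrite /q gtrBl divr_gt0.
  have q0 : 0 < q n by near: n; apply: cvgr_gt q_lim _ _.
  have X1 : X n < 1 by near: n; apply: cvgr_lt X_lim _ _.
  have dX : 0 < 1 - X n by rewrite subr_gt0.
  have k0 : (0 < k n)%N.
    have : 0 < (k n)%:R / n%:R :> R by near: n; apply: cvgr_gt kd _ _.
    by rewrite pmulr_lgt0 ?invr_gt0 // ltr0n.
  (* Since d < 1, there is eventually room for the block above k. *)
  have kn : (k n + l < n)%N.
    have : (k n)%:R / n%:R + l%:R / n%:R < 1 :> R.
      near: n; apply: cvgr_lt; last exact: d1.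
      by rewrite -[X in _ --> X]addr0; apply: cvgD => //; exact: cvg_divn.
    by rewrite -mulrDl -natrD ltr_pdivrMr // mul1r ltr_nat.
  have q01 : 0 < q n < 1 by rewrite q0.
  have BE : B n = l.-1%:R / q n ^+ (k n).-1 *
      ln ((1 - q n ^+ n.+1) / (1 - q n ^+ ((k n).-1 + l).+1)).
    rewrite -addSn prednK // exprD [q n ^+ n.+1]exprSr /B.
    have -> : X n = q n ^+ (k n).-1 * q n by rewrite -exprSr prednK.
    by rewrite mulfK ?gt_eqF // -exprSr prednK // /X.
  have kln : ((k n).-1 + l <= n)%N.
    by apply: leq_trans (ltnW kn); rewrite leq_add2r leq_pred.
  have := mallows_cluster_le_integral q01 b0 l0 kln BE.
  rewrite prednK // -/(X n) -subn1 -/(I (X n)) -/(q n) => hle.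
  rewrite -/(I x) ler_pdivrMr; last first.
    by rewrite !mulr_gt0 ?invr_gt0 ?exprn_gt0 // ltr0n fact_gt0.
  apply: le_trans hle _.
  rewrite (_ : 1 - q n = c / n%:R); last by rewrite /q; ring.
  by rewrite (@rate_identity _ _ _ _ _ _ _ _ x _ (I x)) ?gt_eqF ?exprn_gt0.
have q1m : (1 : R) ^+ (l - 1) != 0 by rewrite expr1n oner_neq0.
have w_lim := cvgM (cvgM (cvgM (cvg_expR (cvg_norm (cvgD (cvg_cst b) B_lim)))
  (cvgV q1m (cvg_exprn (m := l - 1) q_lim))) (cvgM I_lim (cvg_cst (I x)^-1)))
  (cvg_exprn (m := l) (cvgM (cvg_cst (1 - x))
    (cvgV (lt0r_neq0 dx) (cvgB (cvg_cst (1 : R)) X_lim)))).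
move: w_lim; rewrite subrr normr0 expR0 expr1n invr1 !mul1r !divff ?gt_eqF //.
by rewrite expr1n mul1r; exact.
Unshelve. all: by end_near.
Qed.

Theorem theorem2 (R : realType) (l : nat) (hl : (2 <= l)%N) :
  (forall (c d : R) (k : nat -> nat),
     0 < c -> 0 < d < 1 ->
     asymp_equiv (fun n => (k n)%:R) (fun n => d * n%:R) ->
     asymp_le
       (fun n => mallows (1 - c / n%:R) (cluster_event n l (k n)))
       (fun n =>
          1 / (1 - expR (- (c * d))) ^+ l
          * (\int[lebesgue_measure]_(y in `[expR (- (c * d)), 1])
               (y ^+ (l - 1)
                * expR (ln ((1 - expR (- (c * d))) / (1 - expR (- c)))
                        * expR (c * d) * (l - 1)%:R * y)))
          * (c ^+ (l - 1) * (l`!)%:R / n%:R ^+ (l - 1))))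
  /\
  (forall (q : nat -> R) (k : nat -> nat),
     (forall n, (0 < n)%N -> q n < 1) ->
     (fun n => 1 - q n) =o_\oo (fun n => n%:R^-1 : R) ->
     (forall n, (l <= n)%N -> (1 <= k n <= n - l + 1)%N) ->
     asymp_le
       (fun n => mallows (q n) (cluster_event n l (k n)))
       (fun n => (l`!)%:R / n%:R ^+ (l - 1))).
Proof.
split=> [c d k c0 d01 kd|q k q1 qo hk].
  (* The integrand is [pow_exp] unfolded, so the two claims are convertible. *)
  exact: asymp_le_mallows_linear.
exact: asymp_le_mallows_uniform.
Qed.
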